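(* Let $F$ be a separable uniformly convex Banach space with the $\pi_\lambda$-property, where $1\leq\lambda<\Lambda_F$. Let $E$ be a Banach space such that $E^*$ is separable. If $Z$ is a closed subspace of $\mathcal{B}(E,F)$ containing $\mathcal{F}(E,F)$, then $Z$ has the UBCP.
   Context: $\mathcal{B}(E,F)$ is the Banach space of bounded linear operators $E\to F$ with the operator norm, and $\mathcal{F}(E,F)$ is its subspace of bounded finite-rank operators. Uniform ball-covering property (UBCP): a Banach space $Z$ with unit sphere $S_Z$ has the UBCP if there exist $r>0$ and a sequence $(z_j)_{j\ge1}$ in $Z$ such that $S_Z\subseteq\bigcup_{j\ge1}B(z_j,r)$ and $r<\inf_{j\ge1}\|z_j\|$, where $B(z,r)$ is the open ball with center $z$ and radius $r$. By convention, if $Z=\{0\}$ (so $S_Z=\emptyset$) the UBCP assertion is regarded as trivially true. $\pi_\lambda$-property ($\lambda\ge1$): a Banach space $F$ has it if for every finite set $A\subseteq F$ and every $\varepsilon>0$ there is a finite-rank projection (bounded linear idempotent) $P:F\to F$ with $\|P\|\leq\lambda$ and $\|Py-y\|<\varepsilon$ for all $y\in A$. Modulus of convexity: $\delta_F(\varepsilon)=\inf\{1-\|\frac{x+y}{2}\| : x,y\in F,\ \|x\|\le1,\ \|y\|\le1,\ \|x-y\|\ge\varepsilon\}$ for $0<\varepsilon\le2$; $F$ is uniformly convex iff $\delta_F(\varepsilon)>0$ for all $0<\varepsilon\le2$. The constant $\Lambda_F$: for uniformly convex $F$, $0<\eta<1$, $\Delta=\delta_F(\eta)$ and $0<t<\Delta/4$,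 put $\alpha_F(\eta,t)=\min\{\frac{\Delta}{4},\ \frac{\Delta}{2}-t,\ \frac{t(1-\eta)}{2}\}>0$, and define $\Lambda_F=1+\sup\{\alpha_F(\eta,t): 0<\eta<1,\ 0<t<\delta_F(\eta)/4\}$, so that $\Lambda_F>1$. *)

(* Defs.v *)
From HB Require Import structures.
From mathcomp Require Import all_boot all_order all_algebra.
From mathcomp Require Import all_classical all_reals all_analysis.
From mathcomp Require Import complex.

Set Implicit Arguments.
Unset Strict Implicit.
Unset Printing Implicit Defensive.

Import Order.TTheory GRing.Theory Num.Theory.
Import numFieldNormedType.Exports.

Local Open Scope classical_set_scope.
Local Open Scope ring_scope.

(* Banach spaces are over the real or the complex numbers.  In a
   [normedModType K] the norm takes its values in [K], so for complex scalars
   it is a nonnegative element of [R[i]]; [toR] and [ofR] move between such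
   values and [R], and [normR] is the usual real-valued norm. *)
Inductive scalar_kind := RealScalars | ComplexScalars.

Definition scalars (R : realType) (k : scalar_kind) : numFieldType :=
  match k with RealScalars => R | ComplexScalars => R[i] end.

Section Scalars.
Variables (R : realType) (k : scalar_kind).

Definition toR : scalars R k -> R :=
  match k with
  | RealScalars => id
  | ComplexScalars => @complex.Re R
  end.

Definition ofR : R -> scalars R k :=
  match k with
  | RealScalars => id
  | ComplexScalars => fun x => (x%:C)%C
  end.

End Scalars.

Arguments toR {R k}.
Arguments ofR {R k}.

Section ScalarsTheory.
Variable R : realType.

Lemma ofRK k : cancel (@ofR R k) toR.
Proof. by case: k. Qed.

Lemma toRK k (x : scalars R k) : 0 <= x -> ofR (toR x) = x.
Proof.
case: k x => //= x x0.
by rewrite [RHS]complexE ger0_Im// mulr0 addr0.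
Qed.

Lemma ofRD k (x y : R) : ofR (x + y) = ofR x + ofR y :> scalars R k.
Proof. by case: k => //=; rewrite rmorphD. Qed.

Lemma ofRM k (x y : R) : ofR (x * y) = ofR x * ofR y :> scalars R k.
Proof. by case: k => //=; rewrite rmorphM. Qed.

Lemma ofRV k (x : R) : ofR x^-1 = (ofR x)^-1 :> scalars R k.
Proof. by case: k => //=; rewrite fmorphV. Qed.

Lemma ofR0 k : ofR 0 = 0 :> scalars R k.
Proof. by case: k. Qed.

Lemma ler_ofR k (x y : R) : ((ofR x : scalars R k) <= ofR y) = (x <= y).
Proof. by case: k => //=; rewrite lecR. Qed.

Lemma ltr_ofR k (x y : R) : ((ofR x : scalars R k) < ofR y) = (x < y).
Proof. by case: k => //=; rewrite ltcR. Qed.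

End ScalarsTheory.

Section RealNorm.
Variables (R : realType) (k : scalar_kind).
Variable V : normedModType (scalars R k).

Definition normR (x : V) : R := toR `|x|.

Lemma ofR_normR (x : V) : ofR (normR x) = `|x|.
Proof. exact: toRK. Qed.

Lemma normR_ge0 (x : V) : 0 <= normR x.
Proof. by rewrite -(ler_ofR k) ofR0 ofR_normR. Qed.

Lemma normRD (x y : V) : normR (x + y) <= normR x + normR y.
Proof. by rewrite -(ler_ofR k) ofRD !ofR_normR ler_normD. Qed.

Lemma normRZ (a : scalars R k) (x : V) : normR (a *: x) = toR `|a| * normR x.
Proof.
by apply: (can_inj (@ofRK R k)); rewrite ofRM !ofR_normR toRK// normrZ.
Qed.

Lemma normR0 : normR 0 = 0.
Proof. by apply: (can_inj (@ofRK R k)); rewrite ofR_normR normr0 ofR0. Qed.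

Lemma normR0_eq0 (x : V) : normR x = 0 -> x = 0.
Proof. by move=> x0; apply: normr0_eq0; rewrite -ofR_normR x0 ofR0. Qed.

End RealNorm.

Arguments normR {R k V}.

Section BoundedOperators.
Variables (R : realType) (k : scalar_kind).
Local Notation K := (scalars R k).
Variables E F : normedModType K.

Definition bounded_linear : {pred E -> F} :=
  mem [set f : E -> F | linear f /\
    exists M : R, forall x, normR (f x) <= M * normR x].

Lemma bounded_linearP (f : E -> F) : reflect
  (linear f /\ exists M : R, forall x, normR (f x) <= M * normR x)
  (f \in bounded_linear).
Proof. exact: asboolP. Qed.

Lemma bounded_linear_submod : submod_closed bounded_linear.
Proof.
split.
  apply/bounded_linearP; split=> [a x y|]; first by rewrite /= scaler0 addr0.
  by exists 0 => x; rewrite normR0 mul0r.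
move=> a f g /bounded_linearP[lf [M Mf]] /bounded_linearP[lg [N Ng]].
apply/bounded_linearP; split=> [b x y|].
  rewrite !fctE lf lg !scalerDr !scalerA addrACA; congr (_ + _).
  by rewrite mulrC.
exists (toR `|a| * M + N) => x; rewrite !fctE.
apply: (le_trans (normRD _ _)).
rewrite mulrDl lerD// normRZ -mulrA ler_wpM2l//.
by rewrite -(ler_ofR k) (@toRK R k)// ofR0.
Qed.

HB.instance Definition _ := GRing.isSubmodClosed.Build K (E -> F)
  bounded_linear bounded_linear_submod.

Record boundedOp := BoundedOp {
  boundedOp_fun :> E -> F;
  boundedOpP : boundedOp_fun \in bounded_linear }.

HB.instance Definition _ := [isSub for boundedOp_fun].
HB.instance Definition _ := [Choice of boundedOp by <:].
HB.instance Definition _ := [SubChoice_isSubLmodule of boundedOp by <:].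

HB.instance Definition _ (T : boundedOp) :=
  GRing.isLinear.Build K E F *:%R T
    (proj1 (elimT (bounded_linearP T) (boundedOpP T))).

Lemma boundedOp_bounded (T : boundedOp) :
  exists M : R, forall x, normR (T x) <= M * normR x.
Proof. by have /bounded_linearP[] := boundedOpP T. Qed.

Lemma boundedOp_ext (S T : boundedOp) : (forall x, S x = T x) -> S = T.
Proof. by move=> ST; apply: val_inj; apply/funext. Qed.

Lemma boundedOpDE (S T : boundedOp) x : (S + T) x = S x + T x.
Proof. by []. Qed.

Lemma boundedOpZE a (T : boundedOp) x : (a *: T) x = a *: T x.
Proof. by []. Qed.

Definition opnorm (T : boundedOp) : R :=
  sup [set normR (T x) | x in [set x : E | normR x <= 1]].

Lemma opnorm_has_sup (T : boundedOp) :
  has_sup [set normR (T x) | x in [set x : E | normR x <= 1]].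
Proof.
split; first by exists (normR (T 0)), 0 => //=; rewrite normR0.
have [M MT] := boundedOp_bounded T; exists `|M| => _ [x /= x1 <-].
apply: (le_trans (MT x)); apply: (@le_trans _ _ (`|M| * normR x)).
  by rewrite ler_wpM2r ?normR_ge0 ?ler_norm.
by rewrite -[leRHS]mulr1 ler_wpM2l.
Qed.

Lemma le_opnorm1 (T : boundedOp) (x : E) :
  normR x <= 1 -> normR (T x) <= opnorm T.
Proof.
move=> x1; have [_ ub] := opnorm_has_sup T.
by apply: ub_le_sup => //; exists x.
Qed.

Lemma opnorm_le (T : boundedOp) (M : R) :
  (forall x, normR x <= 1 -> normR (T x) <= M) -> opnorm T <= M.
Proof.
move=> TM; apply: ge_sup; first by have [] := opnorm_has_sup T.
by move=> _ [x /= x1 <-]; exact: TM.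
Qed.

Lemma opnorm_ge0 (T : boundedOp) : 0 <= opnorm T.
Proof.
by rewrite (le_trans (normR_ge0 (T 0)))// le_opnorm1// normR0.
Qed.

Lemma le_opnorm (T : boundedOp) (x : E) :
  normR (T x) <= opnorm T * normR x.
Proof.
have [x0|x0] := eqVneq (normR x) 0.
  by rewrite (normR0_eq0 x0) linear0 !normR0 mulr0.
have xp : 0 < normR x by rewrite lt_def x0 normR_ge0.
have c0 : (0 : K) <= ofR (normR x)^-1.
  by rewrite -(@ofR0 R k) ler_ofR invr_ge0 normR_ge0.
have nc y (W : normedModType K) (w : W) : 0 <= y ->
    normR ((ofR y : K) *: w) = y * normR w.
  move=> y0; rewrite normRZ ger0_norm ?ofRK//.
  by rewrite -(@ofR0 R k) ler_ofR.
have := @le_opnorm1 T ((ofR (normR x)^-1 : K) *: x).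
rewrite linearZ/= !nc ?invr_ge0 ?normR_ge0// mulVf// lexx => /(_ isT).
by rewrite mulrC ler_pdivrMr.
Qed.

Definition boundedOp_norm (T : boundedOp) : K := ofR (opnorm T).

Lemma boundedOp_normD (S T : boundedOp) :
  boundedOp_norm (S + T) <= boundedOp_norm S + boundedOp_norm T.
Proof.
rewrite -ofRD ler_ofR; apply: opnorm_le => x x1.
by rewrite boundedOpDE (le_trans (normRD _ _))// lerD// le_opnorm1.
Qed.

Lemma boundedOp_normZ (a : K) (T : boundedOp) :
  boundedOp_norm (a *: T) = `|a| * boundedOp_norm T.
Proof.
have le1 b (S : boundedOp) : opnorm (b *: S) <= toR `|b| * opnorm S.
  apply: opnorm_le => x x1; rewrite boundedOpZE normRZ ler_wpM2l//.
    by rewrite -(ler_ofR k) toRK// ofR0.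
  exact: le_opnorm1.
rewrite -[`|a|](@toRK R k)// -ofRM; congr ofR; apply/eqP; rewrite eq_le le1/=.
have [->|a0] := eqVneq a 0.
  by rewrite normr0 -(@ofR0 R k) ofRK mul0r opnorm_ge0.
have ap : 0 < toR `|a| by rewrite -(ltr_ofR k) toRK// ofR0 normr_gt0.
rewrite -ler_pdivlMl// -[T in opnorm T <= _](scalerK a0).
rewrite (le_trans (le1 _ _))// ler_wpM2r ?opnorm_ge0//.
by rewrite -(ler_ofR k) toRK// normfV ofRV toRK.
Qed.

Lemma boundedOp_norm0_eq0 (T : boundedOp) : boundedOp_norm T = 0 -> T = 0.
Proof.
rewrite /boundedOp_norm -(@ofR0 R k) => /(can_inj (@ofRK R k)) T0.
apply: boundedOp_ext => x; apply: normR0_eq0; apply: le_anti.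
by rewrite normR_ge0 andbT (le_trans (le_opnorm T x))// T0 mul0r.
Qed.

HB.instance Definition _ := Lmodule_isNormed.Build K boundedOp
  boundedOp_normD boundedOp_normZ boundedOp_norm0_eq0.

Lemma normR_boundedOp (T : boundedOp) : normR T = opnorm T.
Proof. exact: ofRK. Qed.

Definition finite_rank (T : boundedOp) : Prop :=
  exists n (y : 'I_n -> F),
    range T = [set \sum_(i < n) c i *: y i | c in [set: 'I_n -> K]].

End BoundedOperators.

Definition dual_space (R : realType) (k : scalar_kind)
    (E : normedModType (scalars R k)) : normedModType (scalars R k) :=
  boundedOp E (scalars R k)^o.

Definition separable (T : topologicalType) : Prop :=
  exists A : set T, countable A /\ dense A.

Section BanachProperties.
Variables (R : realType) (k : scalar_kind).
Local Notation K := (scalars R k).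

(* The UBCP of a linear subspace [Z] of [V] with the norm of [V]: its open
   balls are the traces on [Z] of the balls of [V] centered in [Z]. *)
Definition UBCP (V : normedModType K) (Z : set V) : Prop :=
  Z = [set 0] \/
  exists (r : R) (z : nat -> V),
    [/\ 0 < r,
        forall j, Z (z j),
        [set x | Z x /\ normR x = 1] `<=` \bigcup_j ball (z j) (ofR r) &
        r < inf (range (fun j => normR (z j)))].

Variable F : normedModType K.

Definition pi_property (lam : R) : Prop :=
  forall (A : set F) (e : R), finite_set A -> 0 < e ->
  exists P : boundedOp F F,
    [/\ finite_rank P,
        forall x, P (P x) = P x,
        normR P <= lam &
        forall y, A y -> normR (P y - y) < e].

Local Open Scope ereal_scope.

(* With values in [\bar R] the infimum over the empty set, which occurs only
   for F = 0, is +oo, so the zero space is uniformly convex. *)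
Definition modulus_of_convexity (e : R) : \bar R :=
  ereal_inf [set d | exists x y : F,
    [/\ (normR x <= 1)%R, (normR y <= 1)%R, (e <= normR (x - y))%R &
        d = (1 - normR (2^-1 *: (x + y)))%:E]].

Definition uniformly_convex : Prop :=
  forall e : R, (0 < e <= 2)%R -> 0 < modulus_of_convexity e.

Definition alpha (eta t : R) : \bar R :=
  let D := modulus_of_convexity eta in
  mine (D * (4^-1)%:E)
    (mine (D * (2^-1)%:E - t%:E) (t * (1 - eta) / 2)%:E).

Definition Lambda : \bar R :=
  1 + ereal_sup [set a | exists eta t : R,
    [/\ (0 < eta < 1)%R, (0 < t)%R,
        t%:E < modulus_of_convexity eta * (4^-1)%:E & a = alpha eta t]].

End BanachProperties.

(* Main.v *)
Require Import Defs.
From mathcomp Require Import all_boot all_order all_algebra.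
From mathcomp Require Import all_classical all_reals all_analysis.
From mathcomp Require Import complex lra.

Set Implicit Arguments.
Unset Strict Implicit.
Unset Printing Implicit Defensive.

Import Order.TTheory GRing.Theory Num.Theory.
Import numFieldNormedType.Exports.

Local Open Scope classical_set_scope.
Local Open Scope ring_scope.

(** Let P be a finite-rank projection of F with norm at most lam.  The heart of
    the matter is that, for a suitable small t > 0, the operator t I - P has
    norm at most some rho < 1 which depends on F and lam but not on
    P ([Lambda_contraction]).  Indeed, for y in the unit ball put
    v = P y / lam.  If y and v are far apart, uniform convexity makes the
    midpoint of y and v short; as P v = v, applying P shows that P y itself is
    shorter than 1 by a definite amount, and subtracting the small vector t y
    does not spoil this.  If y and v are close, then
    t y - P y = t (y - v) - (lam - t) v, and the part t v of P y cancelled by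
    t y brings the norm below 1.  The condition lam < Lambda F is what makes
    both estimates compatible for one choice of eta and t.

    Given T of norm 1, pick y in the unit ball with |T y| almost 1 and then P
    with P (T y) close to T y.  The finite-rank operator S = P T has norm
    almost at least 1, while |t T - S| <= rho because T maps the unit ball into
    the unit ball.  Dividing by t, the operator T lies within about rho / t of
    S / t, whose norm is about at least 1 / t: a radius that the norms of the
    centers exceed, uniformly in T.

    It remains to choose the centers from a countable set.  Every bounded
    finite-rank operator is a finite sum of operators x |-> f x *: y with f a
    bounded functional ([finite_rank_sum_rank1]), because coordinates in a
    finite-dimensional normed space are bounded ([coordinates_bounded]).  Taking
    f and y in countable dense sets of E^* and F gives a countable family
    which approximates every finite-rank operator ([rank1_comb_approx]), and
    which lies in Z because Z contains the rank-one operators and is a linear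
    subspace. *)

(** * Norms with values in the reals *)

Section RealNormTheory.
Variables (R : realType) (k : scalar_kind).
Local Notation K := (scalars R k).

Lemma ofR1 : ofR 1 = 1 :> K.
Proof. by case: k. Qed.

Lemma ofRN (x : R) : ofR (- x) = - ofR x :> K.
Proof. by case: k => //=; rewrite rmorphN. Qed.

Lemma normR_ofR (x : R) : toR `|ofR x : K| = `|x|.
Proof.
have pos z : 0 <= z -> toR `|ofR z : K| = z.
  by move=> z0; rewrite ger0_norm ?ofRK// -(ofR0 R k) ler_ofR.
have [x0|/ltW x0] := leP 0 x; first by rewrite pos// ger0_norm.
by rewrite -{1}[x]opprK ofRN normrN pos ?oppr_ge0// ler0_norm.
Qed.

Variable V : normedModType K.
Implicit Types x y : V.

Lemma normR_scale (a : R) x : normR ((ofR a : K) *: x) = `|a| * normR x.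
Proof. by rewrite normRZ normR_ofR. Qed.

Lemma normR_pscale (a : R) x :
  0 <= a -> normR ((ofR a : K) *: x) = a * normR x.
Proof. by move=> a0; rewrite normR_scale ger0_norm. Qed.

Lemma normRN x : normR (- x) = normR x.
Proof. by rewrite /normR normrN. Qed.

Lemma normRB x y : normR (x - y) <= normR x + normR y.
Proof. by rewrite -[normR y]normRN normRD. Qed.

Lemma distRC x y : normR (x - y) = normR (y - x).
Proof. by rewrite -normRN opprB. Qed.

Lemma normR_sum n (x : 'I_n -> V) :
  normR (\sum_i x i) <= \sum_i normR (x i).
Proof.
elim/big_ind2: _ => [|u a v b ua vb|//]; first by rewrite normR0.
by rewrite (le_trans (normRD _ _))// lerD.
Qed.

Lemma ball_normR x y (r : R) : ball x (ofR r) y <-> normR (x - y) < r.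
Proof. by rewrite -ball_normE /= -ofR_normR ltr_ofR. Qed.

Lemma normR_normalize x :
  x != 0 -> normR ((ofR (normR x)^-1 : K) *: x) = 1.
Proof.
move=> x0; rewrite normR_pscale ?invr_ge0 ?normR_ge0// mulVf//.
by apply: contra_neq x0; exact: normR0_eq0.
Qed.

Lemma dense_normR (A : set V) x (e : R) : dense A -> 0 < e ->
  exists2 y, A y & normR (x - y) < e.
Proof.
move=> dA e0; have oe : (0 : K) < ofR e by rewrite -(ofR0 R k) ltr_ofR.
have [||y [/ball_normR yx Ay]] := dA (ball x (ofR e)).
- by exists x; exact: ballxx.
- exact: ball_open.
- by exists y.
Qed.

End RealNormTheory.

(** * Projections shortened by a small multiple of the identity *)

Section ContractionNearProjection.
Variables (R : realType) (k : scalar_kind).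
Local Notation K := (scalars R k).
Variable F : normedModType K.

Lemma modulus_le (D eta : R) (x y : F) :
  (D%:E <= modulus_of_convexity F eta)%E ->
  normR x <= 1 -> normR y <= 1 -> eta <= normR (x - y) ->
  normR (x + y) <= 2 * (1 - D).
Proof.
move=> De x1 y1 xy.
have : (D%:E <= (1 - normR ((2^-1 : K) *: (x + y)))%:E)%E.
  by apply: (le_trans De); apply: ereal_inf_lbound; exists x, y.
have -> : (2^-1 : K) = ofR 2^-1.
  by rewrite ofRV (_ : 2 = 1 + 1 :> R)// ofRD ofR1.
rewrite normR_pscale ?invr_ge0 ?ler0n// lee_fin.
lra.
Qed.

(** The vector y is compared with v = P y / lam rather than with P y, since the
    modulus of convexity only speaks of vectors of the unit ball.  The two
    bounds correspond to the cases where y and v are at distance at least eta,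
    and less than eta. *)
Lemma projection_contraction (D eta lam t : R) (P : boundedOp F F) (y : F) :
  (D%:E <= modulus_of_convexity F eta)%E ->
  0 < t -> t <= 1 -> 1 <= lam ->
  (forall x, P (P x) = P x) -> normR P <= lam -> normR y <= 1 ->
  normR ((ofR t : K) *: y - P y) <=
    Num.max (2 * lam ^+ 2 / (1 + lam) * (1 - D) + t) (t * eta + (lam - t)).
Proof.
move=> De t0 t1 l1 PP Pl y1.
have l0 : 0 <= lam by lra.
have ln0 : lam != 0 by rewrite gt_eqF//; lra.
have Py x : normR (P x) <= lam * normR x.
  rewrite (le_trans (le_opnorm P x))// ler_wpM2r ?normR_ge0//.
  by rewrite -normR_boundedOp.
set v : F := (ofR lam^-1 : K) *: P y.
have v1 : normR v <= 1.
  rewrite normR_pscale ?invr_ge0// ler_pdivrMl ?lt_def ?ln0// mulr1.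
  by rewrite (le_trans (Py y))// ler_piMr.
have PyE : P y = (ofR lam : K) *: v.
  by rewrite scalerA -ofRM divff// ofR1 scale1r.
have Pv : P v = v by rewrite /v linearZ/= PP.
clearbody v.
rewrite le_max; have [yv|yv] := leP eta (normR (y - v)).
  (* P fixes v, so P (y + v) = (lam + 1) v and the bound on y + v bounds v. *)
  apply/orP; left.
  rewrite (le_trans (normRB _ _))// normR_pscale ?(ltW t0)// addrC.
  rewrite lerD//; last by rewrite ler_piMr// ltW.
  have yvD := modulus_le De y1 v1 yv.
  have : normR (P (y + v)) <= lam * (2 * (1 - D)).
    by rewrite (le_trans (Py _))// ler_wpM2l.
  rewrite linearD/= Pv PyE -{2}[v]scale1r -(ofR1 R k) -scalerDl -ofRD.
  rewrite !normR_pscale ?addr_ge0// => vD.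
  rewrite [2 * _ / _ * _]mulrAC ler_pdivlMr; last by lra.
  have := ler_wpM2l l0 vD; lra.
(* The part t v of P y = lam v is cancelled by t y, up to t (y - v). *)
apply/orP; right.
have -> : (ofR t : K) *: y - P y =
    (ofR t : K) *: (y - v) - (ofR (lam - t) : K) *: v.
  rewrite PyE ofRD ofRN scalerBr scalerBl -addrA; congr (_ + _).
  by rewrite opprB addKr.
have lt0 : 0 <= lam - t by lra.
rewrite (le_trans (normRB _ _))// !normR_pscale ?(ltW t0)//.
by apply: lerD; [apply: ler_wpM2l; exact: ltW | exact: ler_piMr].
Qed.

(** The pair (v, - v) competes in the infimum.  The unit vector is there to
    exclude the zero space, whose modulus is infinite for eta > 0. *)
Lemma modulus_le1 (eta : R) (v : F) : eta <= 2 -> normR v = 1 ->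
  (modulus_of_convexity F eta <= 1)%E.
Proof.
move=> e2 v1; apply: ereal_inf_lbound; exists v, (- v); split.
- by rewrite v1.
- by rewrite normRN v1.
- rewrite opprK -[v]scale1r -(ofR1 R k) -scalerDl -ofRD.
  by rewrite normR_pscale ?v1 ?mulr1.
- by rewrite subrr scaler0 normR0 subr0.
Qed.

(** The three terms of the minimum alpha eta t bound lam - 1.  The last one
    makes the close case of [projection_contraction] less than 1; the other two
    absorb the factor 2 lam^2 / (1 + lam) and the summand t of the far case. *)
Lemma Lambda_contraction (lam : R) (v : F) :
  1 <= lam -> (lam%:E < Lambda F)%E -> normR v = 1 ->
  exists t rho : R, [/\ 0 < t, rho < 1 &
    forall (P : boundedOp F F) (y : F),
      (forall x, P (P x) = P x) -> normR P <= lam -> normR y <= 1 ->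
      normR ((ofR t : K) *: y - P y) <= rho].
Proof.
move=> l1 lL v1.
have : ((lam - 1)%:E < ereal_sup [set a | exists eta t : R,
    [/\ (0 < eta < 1)%R, (0 < t)%R,
        (t%:E < modulus_of_convexity F eta * (4^-1)%:E)%E &
        a = alpha F eta t]])%E.
  by rewrite EFinB lteBlDl.
move=> /ereal_sup_gt[_ [eta [t [/andP[e0 e1] t0 tD ->]]]].
have D1 : (modulus_of_convexity F eta <= 1)%E by apply: modulus_le1 v1; lra.
have [D DE] : exists D, modulus_of_convexity F eta = D%:E.
  case: (modulus_of_convexity F eta) tD D1 => [D _ _| |]//; first by exists D.
  by rewrite mulNyr gtr0_sg ?invr_gt0// mul1e.
have De : (D%:E <= modulus_of_convexity F eta)%E by rewrite DE.
move: tD D1; rewrite /alpha DE -!EFinM -EFinB !lt_min !lte_fin lee_fin.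
move=> tD D1 /and3P[lD lDt lt].
exists t, (Num.max (2 * lam ^+ 2 / (1 + lam) * (1 - D) + t)
                   (t * eta + (lam - t))).
split=> // [|P y PP Pl y1]; last by apply: projection_contraction => //; lra.
rewrite gt_max; apply/andP; split; last by nra.
rewrite -ltrBrDr [2 * _ / _ * _]mulrAC ltr_pdivrMr; last by lra.
have [a aE] : exists a, lam = 1 + a by exists (lam - 1); lra.
by subst lam; nra.
Qed.

End ContractionNearProjection.

(** * Coordinates in finite dimension *)

Section BoundedCoordinates.
Variables (R : realType) (k : scalar_kind).
Local Notation K := (scalars R k).
Variable V : normedModType K.

Lemma le_rV_norm m (a : 'rV[R]_m) i : `|a 0 i| <= `|a|.
Proof.
rewrite (mx_normrE a : `|a| = _).
by apply/bigmax_geP; right => /=; exists (0, i).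
Qed.

(** The norm of the combination is a continuous function of its coefficients,
    hence attains a minimum on the compact unit sphere; independence makes this
    minimum positive, and homogeneity does the rest.  Real coefficients are used
    even for complex V, because bounded closed sets of real row vectors are
    compact. *)
Lemma real_coordinates_bounded m (y : 'I_m -> V) :
  (forall a : 'rV[R]_m, \sum_i (ofR (a 0 i) : K) *: y i = 0 -> a = 0) ->
  exists M : R, forall a : 'rV[R]_m,
    `|a| <= M * normR (\sum_i (ofR (a 0 i) : K) *: y i).
Proof.
pose L (a : 'rV[R]_m) := \sum_i (ofR (a 0 i) : K) *: y i; rewrite -/L => L_inj.
have LB a b : L (a - b) = L a - L b.
  rewrite /L -sumrB; apply: eq_bigr => i _.
  by rewrite !mxE ofRD ofRN scalerBl.
have LZ s a : L (s *: a) = (ofR s : K) *: L a.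
  by rewrite /L scaler_sumr; apply: eq_bigr => i _; rewrite mxE ofRM scalerA.
pose C := \sum_i normR (y i).
have C0 : 0 <= C by apply: sumr_ge0 => i _; exact: normR_ge0.
have LC a : normR (L a) <= C * `|a|.
  rewrite (le_trans (normR_sum _))// /C mulr_suml ler_sum// => i _.
  by rewrite normR_scale mulrC ler_wpM2l ?normR_ge0 ?le_rV_norm.
have Lcont : continuous (fun a => normR (L a)).
  move=> a; apply: (iffRL (@cvgrPdist_lt _ R^o _ (nbhs a) _ _ _)) => e e0.
  apply/nbhs_ballP.
  exists (e / (C + 1)) => [|b]; first by rewrite /= divr_gt0 ?ltr_wpDl.
  rewrite -ball_normE /= ltr_pdivlMr ?ltr_wpDl// => ab.
  have LabB : `|normR (L a) - normR (L b)| <= normR (L (a - b)).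
    rewrite LB ler_norml; have := normRD (L a - L b) (L b).
    have := normRD (L b - L a) (L a); rewrite !subrK distRC; lra.
  apply: le_lt_trans ab; rewrite (le_trans LabB)// (le_trans (LC _))//.
  by rewrite mulrC ler_wpM2l// lerDl.
pose S := [set a : 'rV[R]_m | `|a| = 1].
have norm_div a : a != 0 -> S (`|a|^-1 *: a).
  move=> a0; rewrite /S/= normrZ normfV normr_id mulVf// normr_eq0//.
(* The unit sphere is empty when m = 0. *)
have [S0|S0] := pselect (S !=set0); last first.
  exists 0 => a; have [->|/norm_div Sa] := eqVneq a 0.
    by rewrite normr0 mul0r.
  by case: S0; eexists; exact: Sa.
have Scompact : compact S.
  apply: bounded_closed_compact.
    by exists 1; split=> // x x1 a; rewrite /S/= => ->; exact: ltW.
  apply: (@preimage_closed _ _ (fun a : 'rV[R]_m => `|a|) [set (1 : R)]).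
    by move=> a _; exact: norm_continuous.
  exact: closed_eq.
have [c + cmin] := EVT_min_rV S0 Scompact (continuous_subspaceT Lcont).
rewrite inE => /= Sc.
have Lc : 0 < normR (L c).
  rewrite lt_def normR_ge0 andbT; apply/eqP => /normR0_eq0/L_inj c0.
  by move: Sc; rewrite /S/= c0 normr0 => /eqP; rewrite eq_sym oner_eq0.
exists (normR (L c))^-1 => a.
have [->|a0] := eqVneq a 0.
  by rewrite normr0 mulr_ge0 ?invr_ge0 ?normR_ge0.
have := cmin _ (mem_set (norm_div _ a0)).
rewrite LZ normR_pscale ?invr_ge0// ler_pdivlMl ?normr_gt0// => h.
by rewrite ler_pdivlMl// mulrC.
Qed.

End BoundedCoordinates.

(** For complex scalars the real result applies to the vectors y i together with
    their multiples by the imaginary unit, whose real coordinates are the real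
    and imaginary parts of the complex ones. *)
Lemma coordinates_bounded (R : realType) (k : scalar_kind)
    (V : normedModType (scalars R k)) n (y : 'I_n -> V) :
  (forall c : 'I_n -> scalars R k, \sum_i c i *: y i = 0 -> c = (fun=> 0)) ->
  exists M : R, forall (c : 'I_n -> scalars R k) i,
    toR `|c i| <= M * normR (\sum_i c i *: y i).
Proof.
case: k V y => V y y_free.
  have [|M LM] := @real_coordinates_bounded R RealScalars V n y.
    move=> a /= ay; apply/rowP => i; rewrite mxE.
    exact: (congr1 (fun f => f i) (y_free (a 0) ay)).
  exists M => c i.
  have -> : \sum_i c i *: y i =
      \sum_i (ofR ((\row_i c i) 0 i) : scalars R RealScalars) *: y i.
    by apply: eq_bigr => j _; rewrite mxE.
  apply: le_trans (LM _); have {1}-> : c i = (\row_i c i) 0 i by rewrite mxE.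
  exact: le_rV_norm.
pose w (j : 'I_(n + n)) : V :=
  match fintype.split j with inl i => y i | inr i => ('i%C : R[i]) *: y i end.
have wE (a : 'rV[R]_(n + n)) :
    \sum_j (ofR (a 0 j) : scalars R ComplexScalars) *: w j =
    \sum_i ((a 0 (lshift n i) +i* a 0 (rshift n i))%C : R[i]) *: y i.
  rewrite big_split_ord/= -big_split/=; apply: eq_bigr => i _.
  rewrite /w (unsplitK (inl i)) (unsplitK (inr i)) scalerA -scalerDl.
  by congr (_ *: _); simpc.
have [|M LM] := @real_coordinates_bounded R ComplexScalars V _ w.
  move=> a; rewrite wE => /y_free ya; apply/rowP => j; rewrite mxE.
  have ya' i := congr1 (fun f => f i) ya.
  by rewrite -[j]splitK; case: (fintype.split j) => i /=; case: (ya' i).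
exists (M *+ 2) => c i.
pose a := row_mx (\row_i complex.Re (c i)) (\row_i complex.Im (c i)).
have := LM a; rewrite wE.
rewrite (_ : \sum_(i < n) _ = \sum_i c i *: y i); last first.
  apply: eq_bigr => j _; rewrite row_mxEl row_mxEr !mxE.
  by case: (c j).
rewrite mulrnAl mulr2n => aM.
have Re_le : `|complex.Re (c i)| <= `|a|.
  by have := le_rV_norm a (lshift n i); rewrite row_mxEl mxE.
have Im_le : `|complex.Im (c i)| <= `|a|.
  by have := le_rV_norm a (rshift n i); rewrite row_mxEr mxE.
apply: (@le_trans _ _ (`|complex.Re (c i)| + `|complex.Im (c i)|)); last first.
  by apply: lerD; [apply: le_trans Re_le aM | apply: le_trans Im_le aM].
case: (c i) => u v; rewrite /= -[leRHS]ger0_norm ?addr_ge0// -sqrtr_sqr.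
rewrite ler_sqrt ?sqr_ge0// sqrrD !real_normK ?num_real//.
by rewrite lerD2r lerDl mulrn_wge0 ?mulr_ge0.
Qed.

(** * Finite-rank operators as sums of rank-one operators *)

Section FiniteRankOperators.
Variables (R : realType) (k : scalar_kind).
Local Notation K := (scalars R k).
Local Notation functional E := (boundedOp E K^o).
Implicit Types E F G : normedModType K.

Lemma normR_op_le E F (T : boundedOp E F) (M : R) :
  (forall x, normR x <= 1 -> normR (T x) <= M) -> normR T <= M.
Proof. by move=> TM; rewrite normR_boundedOp; exact: opnorm_le. Qed.

Lemma compOp_bounded_linear E F G (S : boundedOp F G) (T : boundedOp E F) :
  (fun x => S (T x)) \in @bounded_linear R k E G.
Proof.
apply/bounded_linearP; split=> [a x y|]; first by rewrite !linearP.
exists (opnorm S * opnorm T) => x; rewrite (le_trans (le_opnorm S _))//.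
by rewrite -mulrA ler_wpM2l ?opnorm_ge0// le_opnorm.
Qed.

Definition compOp E F G (S : boundedOp F G) (T : boundedOp E F) :
  boundedOp E G := BoundedOp (compOp_bounded_linear S T).

Lemma rank1_bounded_linear E F (f : functional E) (y : F) :
  (fun x => (f x : K) *: y) \in @bounded_linear R k E F.
Proof.
apply/bounded_linearP; split=> [a u v|].
  by rewrite linearP scalerDl scalerA.
exists (opnorm f * normR y) => x; rewrite normRZ mulrAC.
by rewrite ler_wpM2r ?normR_ge0// (le_opnorm f).
Qed.

Definition rank1 E F (f : functional E) (y : F) : boundedOp E F :=
  BoundedOp (rank1_bounded_linear f y).

Lemma normR_rank1 E F (f : functional E) (y : F) :
  normR (rank1 f y) <= normR f * normR y.
Proof.
apply: normR_op_le => x x1; rewrite /= normRZ ler_wpM2r ?normR_ge0//.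
by rewrite normR_boundedOp (@le_opnorm1 _ _ _ _ f).
Qed.

Lemma rank1_finite_rank E F (f : functional E) (y : F) :
  finite_rank (rank1 f y).
Proof.
have [[x fx]|f0] := pselect (exists x, f x != 0).
  exists 1, (fun=> y); apply/seteqP; split=> [_ [z _ <-]|_ [c _ <-]].
    by exists (fun=> f z) => //; rewrite big_ord1.
  exists ((c ord0 / f x) *: x) => //=.
  by rewrite linearZ big_ord1/= -[_ *: f x]/(_ * f x) divfK.
(* The zero operator has range spanned by the empty family. *)
exists 0, (fun=> y); apply/seteqP; split=> [_ [z _ <-]|_ [c _ <-]].
  exists (fun=> 0) => //; rewrite big_ord0/=.
  have [->|fz] := eqVneq (f z) 0; first by rewrite scale0r.
  by case: f0; exists z.
by exists 0 => //; rewrite big_ord0 linear0.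
Qed.

Lemma sumOpE E F (I : Type) (r : seq I) (T : I -> boundedOp E F) x :
  (\sum_(i <- r) T i) x = \sum_(i <- r) T i x.
Proof. by elim/big_rec2: _ => // i _ S _ <-. Qed.

(** A spanning family of minimal length is linearly independent: a vector that
    occurs in a nontrivial relation could be dropped. *)
Lemma finite_rank_free_basis E F (T : boundedOp E F) : finite_rank T ->
  exists n (y : 'I_n -> F),
    (forall x, exists c : 'I_n -> K, T x = \sum_i c i *: y i) /\
    (forall c : 'I_n -> K, \sum_i c i *: y i = 0 -> c = (fun=> 0)).
Proof.
move=> [n0 [y0 Ty0]].
pose spans n := `[< exists y : 'I_n -> F,
  forall x, exists c : 'I_n -> K, T x = \sum_i c i *: y i >].
have spans_ex : exists n, spans n.
  exists n0; apply/asboolP; exists y0 => x.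
  have : range T (T x) by exists x.
  by rewrite Ty0 => -[c _ <-]; exists c.
have [n /asboolP[y Ty] nmin] := ex_minnP spans_ex.
exists n, y; split=> // c cy0; apply: contrapT => c0.
have [j cj] : exists j, c j != 0.
  apply: contrapT => cN; apply: c0; apply/funext => j.
  by apply/eqP; apply: contrapT => /negP cj; apply: cN; exists j.
case: n => [|n] in y Ty nmin c cy0 c0 j cj *; first by case: j cj.
suff /nmin : spans n by rewrite ltnn.
apply/asboolP; exists (fun i => y (lift j i)) => x.
have [b ->] := Ty x.
have yj : y j = \sum_i (- (c j)^-1 * c (lift j i)) *: y (lift j i).
  move: cy0; rewrite (bigD1_ord j)//= => /eqP; rewrite addr_eq0 => /eqP cyj.
  rewrite -[LHS]scale1r -(mulVf cj) -scalerA cyj scalerN scaler_sumr -sumrN.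
  by apply: eq_bigr => i _; rewrite scalerA mulNr scaleNr.
exists (fun i => b j * (- (c j)^-1 * c (lift j i)) + b (lift j i)).
rewrite (bigD1_ord j)//= {1}yj scaler_sumr -big_split/=.
by apply: eq_bigr => i _; rewrite scalerDl scalerA.
Qed.

(** The coordinates of T x in an independent spanning family are linear in x by
    uniqueness, and bounded by [coordinates_bounded]; they are the functionals
    of the decomposition. *)
Lemma finite_rank_sum_rank1 E F (T : boundedOp E F) : finite_rank T ->
  exists n (f : 'I_n -> functional E) (y : 'I_n -> F),
    T = \sum_i rank1 (f i) (y i).
Proof.
move=> /finite_rank_free_basis[n [y [/choice[c Tc] y_free]]].
have [M yM] := coordinates_bounded y_free.
have c_bl i : (fun x => c x i : K^o) \in @bounded_linear R k E K^o.
  apply/bounded_linearP; split=> [a u v|].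
    suff /(congr1 (fun g => g i)) /eqP :
        (fun j => c (a *: u + v) j - (a * c u j + c v j)) = (fun=> 0).
      by rewrite subr_eq0 => /eqP.
    apply: y_free; under eq_bigr do rewrite scalerBl scalerDl -scalerA.
    by rewrite sumrB big_split/= -scaler_sumr -!Tc linearP subrr.
  exists (`|M| * opnorm T) => x; apply: (le_trans (yM (c x) i)).
  rewrite -Tc -mulrA; apply: (@le_trans _ _ (`|M| * normR (T x))).
    by rewrite ler_wpM2r ?normR_ge0// ler_norm.
  by rewrite ler_wpM2l// le_opnorm.
exists n, (fun i => BoundedOp (c_bl i)), y; apply: boundedOp_ext => x.
by rewrite sumOpE -Tc.
Qed.

End FiniteRankOperators.

(** * A countable family approximating the finite-rank operators *)

Section CountableApproximation.
Variables (R : realType) (k : scalar_kind).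
Local Notation K := (scalars R k).
Local Notation functional E := (boundedOp E K^o).

Lemma separable_dense_seq (V : normedModType K) : separable V ->
  exists d : nat -> V, forall x (e : R), 0 < e ->
    exists i, normR (x - d i) < e.
Proof.
move=> [A [/countable_injP[f f_inj] dA]].
exists (fun n => xget 0 [set x | A x /\ f x = n]) => x e.
move=> /(dense_normR x dA)[y Ay xy].
exists (f y); case: xgetP => [z _ [Az fzy]|/(_ y)]; last by case; split.
by rewrite (f_inj z y) ?inE.
Qed.

Variables (E F : normedModType K).
Variables (d : nat -> functional E) (e : nat -> F).
Hypothesis d_dense : forall f (eps : R), 0 < eps ->
  exists i, normR (f - d i) < eps.
Hypothesis e_dense : forall y (eps : R), 0 < eps ->
  exists j, normR (y - e j) < eps.

(** Indexing by sequences of pairs of naturals makes the family countable, and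
    turns sums of members into concatenations of indices. *)
Definition rank1_comb (s : seq (nat * nat)) : boundedOp E F :=
  \sum_(p <- s) rank1 (d p.1) (e p.2).

Lemma rank1_comb_approx_rank1 (f : functional E) (y : F) (eps : R) :
  0 < eps -> exists s, normR (rank1 f y - rank1_comb s) < eps.
Proof.
move=> eps0; have y0 : 0 < normR y + 1 by rewrite ltr_wpDl ?normR_ge0.
have [|i fi] := @d_dense f (eps / 2 / (normR y + 1)).
  by rewrite !divr_gt0.
(* The choice of e j depends on i, since d i multiplies the error y - e j. *)
have d0 : 0 < normR (d i) + 1 by rewrite ltr_wpDl ?normR_ge0.
have [|j yj] := @e_dense y (eps / 2 / (normR (d i) + 1)).
  by rewrite !divr_gt0.
exists [:: (i, j)]; rewrite /rank1_comb big_seq1/=.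
have -> : rank1 f y - rank1 (d i) (e j) =
    rank1 (f - d i) y + rank1 (d i) (y - e j).
  apply: boundedOp_ext => x; rewrite [RHS]/=.
  change (f x *: y - d i x *: e j =
    (f x - d i x : K) *: y + d i x *: (y - e j)).
  by rewrite scalerBl scalerBr addrA subrK.
rewrite (le_lt_trans (normRD _ _))// [eps]splitr ltr_leD//.
  rewrite (le_lt_trans (normR_rank1 _ _))//.
  rewrite ltr_pdivlMr// in fi; apply: le_lt_trans fi.
  by rewrite ler_wpM2l ?normR_ge0// lerDl.
rewrite (le_trans (normR_rank1 _ _))// mulrC.
rewrite ltr_pdivlMr// in yj; apply: le_trans (ltW yj).
by rewrite ler_wpM2l ?normR_ge0// lerDl.
Qed.

(** The hypothesis is a decomposition rather than finiteness of the rank,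
    because the decomposition of a composite P T comes directly from that of
    P. *)
Lemma rank1_comb_approx (S : boundedOp E F) (eps : R) :
  (exists n (f : 'I_n -> functional E) (y : 'I_n -> F),
    S = \sum_i rank1 (f i) (y i)) ->
  0 < eps -> exists s, normR (S - rank1_comb s) < eps.
Proof.
move=> [n [f [y ->]]].
elim/big_ind: _ eps => [eps eps0|S1 S2 IH1 IH2 eps eps0|i _].
- by exists [::]; rewrite /rank1_comb big_nil subrr normR0.
- have [|s1 Ss1] := IH1 (eps / 2); first by rewrite divr_gt0.
  have [|s2 Ss2] := IH2 (eps / 2); first by rewrite divr_gt0.
  exists (s1 ++ s2); rewrite /rank1_comb big_cat/= -!/(rank1_comb _).
  rewrite opprD addrACA (le_lt_trans (normRD _ _))// [eps]splitr.
  by rewrite ltrD.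
- by move=> eps; exact: rank1_comb_approx_rank1.
Qed.

(** Only single rank-one operators are shown to have finite rank in the sense of
    a range equal to a span; sums are taken inside Z. *)
Lemma rank1_comb_in (Z : set (boundedOp E F)) s :
  submod_closed (mem Z) -> [set T : boundedOp E F | finite_rank T] `<=` Z ->
  Z (rank1_comb s).
Proof.
move=> [Z0 ZD] fZ; rewrite -inE.
rewrite /rank1_comb; elim: s => [|p s IH]; first by rewrite big_nil.
rewrite big_cons -[rank1 _ _]scale1r; apply: ZD => //.
by apply/mem_set; apply: fZ; exact: rank1_finite_rank.
Qed.

End CountableApproximation.

(** * The uniform ball-covering property *)

Theorem theorem1p1 (R : realType) (k : scalar_kind)
    (E F : completeNormedModType (scalars R k)) (lam : R)
    (Z : set (boundedOp E F)) :
  separable F -> uniformly_convex F ->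
  1 <= lam -> (lam%:E < Lambda F)%E -> pi_property F lam ->
  separable (dual_space E) ->
  submod_closed (mem Z) -> closed Z ->
  [set T : boundedOp E F | finite_rank T] `<=` Z ->
  UBCP Z.
Proof.
move=> sepF _ lam1 lamL piF sepE Zsub _ Zfin.
have [Z0 ZD] := Zsub.
have ZZ a T : Z T -> Z (a *: T).
  move=> ZT; rewrite -inE -[_ *: _]addr0; apply: ZD => //.
  exact/mem_set.
have [[T0 ZT0 T0n]|ZN] := pselect (exists2 T, Z T & T != 0); last first.
  left; apply/seteqP; split=> [T ZT|_ ->]; last by rewrite -inE.
  by apply: contrapT => /eqP T0; apply: ZN; exists T.
right.
have [x Tx] : exists x, T0 x != 0.
  apply: contrapT => TN; move/eqP: T0n; apply; apply: boundedOp_ext => x.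
  by apply/eqP; apply: contrapT => /negP Tx; apply: TN; exists x.
have [t [rho [t0 rho1 contr]]] :=
  Lambda_contraction lam1 lamL (normR_normalize Tx).
have [d d_dense] := separable_dense_seq sepE.
have [e e_dense] := separable_dense_seq sepF.
pose op := rank1_comb (d : nat -> boundedOp E (scalars R k)^o) e.
(* The radius will be (rho + m) / t and the centers will have norm at least
   (1 - 3 m) / t; this m leaves half of the gap 1 - rho between rho + m and
   1 - 3 m. *)
pose m := (1 - rho) / 8.
have m0 : 0 < m by rewrite /m; lra.
have approx T : normR T = 1 ->
    exists s, 1 - 3 * m <= normR (op s) /\
      normR ((ofR t : scalars R k) *: T - op s) < rho + m.
  move=> T1.
  (* Of the loss 3 m in norm, one m comes from the choice of y, one from
     P (T y) and one from the approximation of P T. *)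
  have [_ [y /= y1 <-] Ty] := sup_adherent m0 (opnorm_has_sup T).
  rewrite -/(opnorm T) -normR_boundedOp T1 in Ty.
  have [P [Pfin PP Plam Py]] := piF [set T y] m (finite_set1 _) m0.
  have {Py} PTy := Py _ erefl.
  have [n [f [v Pv]]] := finite_rank_sum_rank1 Pfin.
  have [|s Ps] := rank1_comb_approx d_dense e_dense (S := compOp P T) _ m0.
    exists n, (fun i => compOp (f i) T), v; apply: boundedOp_ext => z.
    by rewrite /= Pv !sumOpE.
  exists s; split; last first.
    have -> : (ofR t : scalars R k) *: T - op s =
        ((ofR t : scalars R k) *: T - compOp P T) + (compOp P T - op s).
      by rewrite addrA subrK.
    rewrite (le_lt_trans (normRD _ _))// ler_ltD//.
    apply: normR_op_le => z z1; apply: contr => //.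
    by rewrite (le_trans (@le_opnorm1 _ _ _ _ T z z1))// -normR_boundedOp T1.
  have PTn : normR (P (T y)) <= normR (compOp P T).
    by rewrite normR_boundedOp; exact: (@le_opnorm1 _ _ _ _ (compOp P T) y y1).
  have := normRD (compOp P T - op s) (op s); rewrite subrK.
  have := normRB (P (T y)) (P (T y) - T y); rewrite opprB addrC subrK.
  lra.
have [s0 [s0n s0T]] := approx _ (normR_normalize T0n).
have tK : (ofR t^-1 : scalars R k) * ofR t = 1.
  by rewrite -ofRM mulVf ?gt_eqF// ofR1.
(* Indices of operators that are too short are redirected to s0. *)
pose c n := if unpickle n is Some s then
  if 1 - 3 * m <= normR (op s) then s else s0 else s0.
have cn n : 1 - 3 * m <= normR (op (c n)).
  by rewrite /c; case: unpickle => // s; case: ifP.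
exists ((rho + m) / t), (fun n => (ofR t^-1 : scalars R k) *: op (c n)); split.
- by rewrite divr_gt0// (le_lt_trans _ s0T)// normR_ge0.
- by move=> n; exact: ZZ (rank1_comb_in _ _ _ Zsub Zfin).
- move=> T [_ T1]; have [s [sn Ts]] := approx T T1.
  exists (pickle s) => //=; apply/ball_normR; rewrite /c pickleK sn distRC.
  have -> : T = (ofR t^-1 : scalars R k) *: ((ofR t : scalars R k) *: T).
    by rewrite scalerA tK scale1r.
  rewrite -scalerBr normR_pscale ?invr_ge0 ?(ltW t0)// mulrC.
  by rewrite ltr_pM2r ?invr_gt0.
- apply: (@lt_le_trans _ _ ((1 - 3 * m) / t)).
    by rewrite ltr_pM2r ?invr_gt0// /m; lra.
  apply: lb_le_inf; first by eexists; exists 0%N.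
  move=> _ [n _ <-]; rewrite normR_pscale ?invr_ge0 ?(ltW t0)// mulrC.
  by rewrite ler_wpM2l ?invr_ge0 ?(ltW t0).
Qed.
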